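(* For every constant integer $d\ge 2$ and every $n$, there exists a $d$-dimensional poset $G$ on $n$ elements such that for all integers $k\ge 3$, every Steiner $k$-TC-spanner of $G$ has $\Omega\big(n\log^{\lceil (d-1)/k\rceil} n\big)$ edges (the implied constant may depend on $d$ but not on $n$).
   Context: A poset is identified with the DAG whose reachability relation is its order. The dimension of an $n$-element poset $G$ is the smallest $d$ such that $G$ embeds (via a map $f$ with $x\preceq y$ iff $f(x)\preceq f(y)$) into $[n]^d$ with the dominance order ($x\preceq y$ iff $x_i\le y_i$ for all $i$). For a directed graph $G=(V,E)$ and integer $k\ge1$, a Steiner $k$-TC-spanner of $G$ is a directed graph $H=(V_H,E_H)$ with $V\subseteq V_H$ such that for all $u,v\in V$: if $v$ is reachable from $u$ in $G$ then $H$ has a path from $u$ to $v$ of length at most $k$, and if not then $v$ is not reachable from $u$ in $H$. Logarithms are base 2. *)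

(* Defs.v *)
From mathcomp Require Import all_boot.
From Stdlib Require Import Reals.

Set Implicit Arguments.
Unset Strict Implicit.
Unset Printing Implicit Defensive.

(* A poset on the n elements 'I_n, given by its order relation
   (= the reachability relation of the associated DAG). *)
Definition is_poset (n : nat) (le : rel 'I_n) : Prop :=
  reflexive le /\ antisymmetric le /\ transitive le.

(* G embeds into [n]^d with the dominance order
   (coordinates taken in 'I_n = {0,...,n-1}, a copy of [n]). *)
Definition embeds_dominance (n : nat) (le : rel 'I_n) (d : nat) : Prop :=
  exists f : 'I_n -> 'I_d -> 'I_n,
    forall x y, le x y <-> (forall i, f x i <= f y i).

Definition poset_dim_eq (n : nat) (le : rel 'I_n) (d : nat) : Prop :=
  embeds_dominance le d /\ forall d', d' < d -> ~ embeds_dominance le d'.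

(* H = (T, E) is a Steiner k-TC-spanner of the poset G = ('I_n, le), where
   emb : 'I_n -> T is the (injective) inclusion V ⊆ V_H. *)
Definition steiner_tc_spanner (n : nat) (le : rel 'I_n) (k : nat)
    (T : finType) (E : rel T) (emb : 'I_n -> T) : Prop :=
  injective emb /\
  forall u v : 'I_n,
    (le u v ->
       exists p : seq T, [/\ size p <= k, path E (emb u) p & last (emb u) p = emb v])
    /\ (~~ le u v -> ~~ connect E (emb u) (emb v)).

Definition num_edges (T : finType) (E : rel T) : nat :=
  #|[set p : T * T | E p.1 p.2]|.

Definition log2 (x : R) : R := (ln x / ln 2)%R.

Definition ceil_div (a b : nat) : nat := (a + b - 1) %/ b.

(* Main.v *)
Require Import Defs.
From mathcomp Require Import all_boot zify.
From Stdlib Require Import Reals Lra.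
(* Reals rebinds [^] on nat and the name [family]. *)
From mathcomp Require Import ssrnat finfun.

Set Implicit Arguments.
Unset Strict Implicit.
Unset Printing Implicit Defensive.

(* With q = d - 1, the hard poset is a Halton point set: the point z < m has
   coordinates z and, for q distinct primes p_j, the reversal of the first A
   base-p_j digits of z. By the Chinese remainder theorem, for each tuple of
   levels a in [A]^q and each cell of the corresponding partition into
   p_j-adic boxes, the points of the cell form an arithmetic progression in z
   in which points with next digits (0,...,0) and (1,...,1) alternate at a
   bounded rate. This gives Omega(m) comparable pairs (x, y) per tuple a, whose
   order intervals are disjoint in the pair (box, z).

   Every Steiner vertex receives coordinates by taking maxima over its
   predecessors, so a path from x to y is monotone and stays in the order
   interval of x and y. In each of the q coordinates it must cross from one
   sub-interval to another; with at most k edges, one edge crosses in at least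
   t = ceil(q/k) coordinates. An edge crosses coordinate j at a single level,
   so it serves at most 2^q A^(q-t) tuples a. Double counting over the A^q
   tuples yields Omega(m A^t) edges, and A is of order log m.

   Adding a standard example on 2d elements makes the dimension exactly d. *)

(** * Chinese remainder theorem for finite families *)

Lemma modn_dvd_eq (m d x y : nat) :
  d %| m -> x = y %[mod m] -> x = y %[mod d].
Proof. by move=> dm e; rewrite -(modn_dvdm x dm) e modn_dvdm. Qed.

Lemma coprime_prod (I : eqType) (s : seq I) (F : I -> nat) (m : nat) :
  {in s, forall i, coprime m (F i)} -> coprime m (\prod_(i <- s) F i).
Proof.
elim: s => [|i s IH] h; first by rewrite big_nil coprimen1.
rewrite big_cons coprimeMr h ?mem_head //= IH // => j js.
by apply: h; rewrite inE js orbT.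
Qed.

Section Chinese.

Variables (I : finType) (F : I -> nat).
Hypothesis coF : forall i j, i != j -> coprime (F i) (F j).

Lemma coprime_prod_uniq (i : I) (s : seq I) :
  i \notin s -> coprime (F i) (\prod_(j <- s) F j).
Proof.
by move=> nis; apply: coprime_prod => j js; apply: coF; apply: contraNneq nis => ->.
Qed.

Lemma chinese_family (r : I -> nat) :
  exists x, forall i, x = r i %[mod F i].
Proof.
suff [x hx] : exists x, {in enum I, forall i, x = r i %[mod F i]}.
  by exists x => i; apply: hx; rewrite mem_enum.
have := enum_uniq I; elim: (enum I) => [|i s IH] /=; first by exists 0.
case/andP=> nis /IH[x hx].
have co := coprime_prod_uniq nis.
exists (chinese (F i) (\prod_(j <- s) F j) (r i) x) => j; rewrite inE.
case/predU1P=> [->|js]; first exact: chinese_modl.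
rewrite -hx //; apply: (@modn_dvd_eq (\prod_(j <- s) F j)); last exact: chinese_modr.
by rewrite (big_rem j) //= dvdn_mulr.
Qed.

Lemma eq_mod_prod (x y : nat) :
  (forall i, x = y %[mod F i]) -> x = y %[mod \prod_i F i].
Proof.
move=> h; rewrite -big_enum /=; have := enum_uniq I.
elim: (enum I) => [|i s IH] /=; first by rewrite big_nil !modn1.
case/andP=> nis /IH e; rewrite big_cons; apply/eqP.
by rewrite chinese_remainder ?coprime_prod_uniq //; apply/andP; split; apply/eqP.
Qed.

End Chinese.

(** * Digit reversal *)

(* The first [a] base-[p] digits of [z], read as a numeral with the least
   significant digit of [z] leading. *)
Fixpoint digit_rev (p a z : nat) : nat :=
  if a is b.+1 then digit_rev p b z * p + (z %/ p ^ b) %% p else 0.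

Section DigitReversal.

Variable p : nat.
Hypothesis p_gt0 : 0 < p.

Lemma digit_revS_div (a z : nat) : digit_rev p a.+1 z %/ p = digit_rev p a z.
Proof. by rewrite /= divnMDl // divn_small ?addn0 // ltn_mod. Qed.

(** The digits of [z] at positions [a] to [A - 1] are the trailing ones of the reversal. So dividing
    a coordinate by [p ^ (A - a)] names its [p]-adic interval of depth [a]. *)
Lemma digit_rev_div (A a z : nat) :
  a <= A -> digit_rev p A z %/ p ^ (A - a) = digit_rev p a z.
Proof.
move/subnKC; move: (A - a) => b <-; elim: b => [|b IH]; first by rewrite addn0 divn1.
by rewrite addnS expnS divnMA digit_revS_div.
Qed.

Lemma modn_expS (a z : nat) : z %% p ^ a.+1 = (z %/ p ^ a) %% p * p ^ a + z %% p ^ a.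
Proof.
have pa : 0 < p ^ a by rewrite expn_gt0 p_gt0.
rewrite {1}(divn_eq z (p ^ a)) {1}(divn_eq (z %/ p ^ a) p) mulnDl -mulnA -expnS -addnA.
rewrite modnMDl modn_small // expnS.
apply: (@leq_trans ((z %/ p ^ a %% p).+1 * p ^ a)).
  by rewrite mulSn addnC ltn_add2r ltn_pmod.
by rewrite leq_mul2r ltn_pmod ?orbT.
Qed.

(** Turns intervals of depth [a] into residue classes of the index, so that the Chinese remainder
    theorem applies to boxes. *)
Lemma digit_rev_eqP (a x y : nat) :
  digit_rev p a x = digit_rev p a y <-> x = y %[mod p ^ a].
Proof.
elim: a => [|a IH]; first by rewrite expn0 !modn1.
have pa : 0 < p ^ a by rewrite expn_gt0 p_gt0.
split=> [e|e].
- have e1 : digit_rev p a x = digit_rev p a y by rewrite -(digit_revS_div a x) e digit_revS_div.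
  have := e; rewrite /= e1 => /addnI e2.
  by rewrite !modn_expS e2 (proj1 IH e1).
- have e1 : x = y %[mod p ^ a] by apply: modn_dvd_eq e; rewrite dvdn_exp2l.
  move: e; rewrite !modn_expS e1 => /addIn/eqP.
  by rewrite eqn_pmul2r // => /eqP e2; rewrite /= (proj2 IH e1) e2.
Qed.

End DigitReversal.

(** * Comparable pairs in the Halton set *)

Section Halton.

(* [q] is the paper's [d - 1]; the last coordinate is the index itself. *)
Variables (q : nat) (p : 'I_q -> nat) (A : nat).
Hypothesis p_gt1 : forall j, 1 < p j.
Hypothesis p_coprime : forall i j, i != j -> coprime (p i) (p j).
Let P := \prod_j p j.

Definition halton_le (x y : nat) : bool :=
  (x <= y) && [forall j, digit_rev (p j) A x <= digit_rev (p j) A y].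

Let p_gt0 j : 0 < p j. Proof. exact: ltnW. Qed.
Let P_gt0 : 0 < P. Proof. by rewrite prodn_gt0. Qed.

Section Levels.

Variable a : {ffun 'I_q -> 'I_A}.
Let Q := \prod_j p j ^ a j.
Let W := 2 * (Q * P).

Let Q_gt0 : 0 < Q. Proof. by rewrite prodn_gt0 // => j; rewrite expn_gt0 p_gt0. Qed.

Lemma prod_levelsS : \prod_j p j ^ (a j).+1 = Q * P.
Proof. by rewrite -big_split /=; apply: eq_bigr => j _; rewrite expnSr. Qed.

Lemma period_le : W <= 2 * P ^ A.
Proof.
rewrite leq_mul2l /= -prod_levelsS.
have -> : P ^ A = \prod_j p j ^ A by apply: (big_morph (expn^~ A)) => [x y|]; rewrite ?expnMn ?exp1n.
by apply: leq_prod => j _; rewrite leq_pexp2l.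
Qed.

(** For each [j] the two requirements fix a single residue modulo [p j ^ (a j).+1]. These moduli are
    coprime with product [Q * P], so every window of that length contains a solution. *)
Lemma digit_prescription (c r s : nat) :
  (forall j, c < p j) ->
  exists x, [/\ s * (Q * P) <= x < s.+1 * (Q * P),
    forall j, x = r %[mod p j ^ a j] & forall j, (x %/ p j ^ a j) %% p j = c].
Proof.
move=> cp.
have co i j : i != j -> coprime (p i ^ (a i).+1) (p j ^ (a j).+1).
  by move=> nij; rewrite coprimeXl // coprimeXr // p_coprime.
have [x hx] := chinese_family co (fun j => c * p j ^ a j + r %% p j ^ a j).
exists (s * (Q * P) + x %% (Q * P)).
have QP0 : 0 < Q * P by rewrite muln_gt0 Q_gt0.
have {}hx j : s * (Q * P) + x %% (Q * P) = c * p j ^ a j + r %% p j ^ a j %[mod p j ^ (a j).+1].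
  have dv : p j ^ (a j).+1 %| Q * P.
    by rewrite -prod_levelsS (bigD1 j) //= dvdn_mulr.
  rewrite -hx; apply: modn_dvd_eq dv _; by rewrite modnMDl modn_mod.
split.
- by rewrite leq_addr /= mulSn addnC ltn_add2r ltn_pmod.
- move=> j; have -> : r = c * p j ^ a j + r %% p j ^ a j %[mod p j ^ a j].
    by rewrite modnMDl modn_mod.
  by apply: modn_dvd_eq (hx j); rewrite dvdn_exp2l.
- move=> j; have pa : 0 < p j ^ a j by rewrite expn_gt0 p_gt0.
  move: (hx j) => /(proj2 (digit_rev_eqP (p_gt0 j) _ _ _)) /= e.
  have : digit_rev (p j) (a j).+1 (s * (Q * P) + x %% (Q * P)) %% p j =
         digit_rev (p j) (a j).+1 (c * p j ^ a j + r %% p j ^ a j) %% p j by rewrite /= e.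
  rewrite /=.
  have -> : (c * p j ^ a j + r %% p j ^ a j) %/ p j ^ a j = c.
    by rewrite divnMDl // (divn_small (ltn_pmod _ pa)) addn0.
  by rewrite !modnMDl !modn_mod (modn_small (cp j)).
Qed.

(** A block of length [W] consists of two windows: [x] comes from the first with all next digits 0,
    [y] from the second with all next digits 1. *)
Lemma halton_pair (r i : nat) :
  exists x y, [/\ halton_le x y, i * W <= x, y < i.+1 * W,
    forall j, digit_rev (p j) (a j) x = digit_rev (p j) (a j) r
              /\ digit_rev (p j) (a j) y = digit_rev (p j) (a j) r
  & forall j, digit_rev (p j) (a j).+1 x < digit_rev (p j) (a j).+1 y].
Proof.
have [x [/andP[x1 x2] x3 x4]] := @digit_prescription 0 r (2 * i) p_gt0.
have [y [/andP[y1 y2] y3 y4]] := @digit_prescription 1 r (2 * i).+1 p_gt1.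
have ex j : digit_rev (p j) (a j) x = digit_rev (p j) (a j) r.
  by apply/digit_rev_eqP.
have ey j : digit_rev (p j) (a j) y = digit_rev (p j) (a j) r.
  by apply/digit_rev_eqP.
have lt j : digit_rev (p j) (a j).+1 x < digit_rev (p j) (a j).+1 y.
  by rewrite /= ex ey x4 y4 addn0 addn1.
exists x, y; split=> //.
- apply/andP; split; first by apply: leq_trans y1; apply: ltnW.
  (* The order of the full reversals is already decided at depth [(a j).+1]. *)
  apply/forallP => j; rewrite leqNgt; apply/negP => /ltnW h.
  have := leq_div2r (p j ^ (A - (a j).+1)) h.
  by rewrite !digit_rev_div ?p_gt0 ?ltn_ord // leqNgt lt.
- by rewrite /W mulnA (mulnC i).
- have e : (2 * i).+2 = i.+1 * 2 by lia.
  by rewrite /W mulnA -e.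
Qed.

End Levels.

End Halton.

(** * Counting level tuples, and the pigeonhole principle *)

Lemma card_bigcup_leq (I T : finType) (D : pred I) (F : I -> {set T}) :
  #|\bigcup_(i | D i) F i| <= \sum_(i | D i) #|F i|.
Proof.
apply: (big_ind2 (fun (X : {set T}) n => #|X| <= n)) => [|X a Y b hX hY|//].
  by rewrite cards0.
by apply: leq_trans (leq_card_setU X Y) _; apply: leq_add.
Qed.

Lemma card_prescribed_ffun (q A : nat) (S : {set 'I_q}) (L : 'I_q -> pred 'I_A) :
  (forall j, #|L j| <= 1) ->
  #|[set a : {ffun 'I_q -> 'I_A} | [forall (j | j \in S), L j (a j)]]| <= A ^ (q - #|S|).
Proof.
move=> L1; pose F j := if j \in S then L j else predT.
apply: (@leq_trans #|(family F : simpl_pred {ffun 'I_q -> 'I_A})|).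
  apply: subset_leq_card; apply/subsetP => a; rewrite inE => /forallP h.
  by apply/familyP => j; rewrite /F; have := h j; case: (j \in S).
rewrite card_family foldrE big_map big_enum /=.
apply: (@leq_trans (\prod_(j < q) if j \in S then 1 else A)).
  apply: leq_prod => j _; rewrite /F; case: ifP => _; first exact: L1.
  by rewrite cardT size_enum_ord.
rewrite (bigID (mem S)) /= big1 ?mul1n; last by move=> j ->.
rewrite (eq_bigr (fun=> A)); last by move=> j /negbTE ->.
rewrite prod_nat_const; have <- : #|~: S| = q - #|S| by rewrite cardsCs setCK card_ord.
by apply: eq_leq; congr (_ ^ _); apply: eq_card => j; rewrite !inE.
Qed.

(** Union bound over the at most [2 ^ q] possible sets [S] of agreeing coordinates; each leaves
    [q - #|S|] entries free. *)
Lemma card_agreeing_ffun (q A t : nat) (L : 'I_q -> pred 'I_A) :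
  0 < A -> (forall j, #|L j| <= 1) ->
  #|[set a : {ffun 'I_q -> 'I_A} | t <= #|[set j | L j (a j)]|]| <= 2 ^ q * A ^ (q - t).
Proof.
move=> A0 L1; pose F (S : {set 'I_q}) := [set a : {ffun 'I_q -> 'I_A} | [forall (j | j \in S), L j (a j)]].
apply: (@leq_trans #|\bigcup_(S : {set 'I_q} | t <= #|S|) F S|).
  apply: subset_leq_card; apply/subsetP => a; rewrite inE => ta.
  apply/bigcupP; exists [set j | L j (a j)] => //; rewrite inE.
  by apply/forallP => j; apply/implyP; rewrite inE.
apply: leq_trans (card_bigcup_leq _ _) _.
apply: (@leq_trans (\sum_(S : {set 'I_q} | t <= #|S|) A ^ (q - t))).
  apply: leq_sum => S tS; apply: leq_trans (card_prescribed_ffun S L1) _.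
  by rewrite leq_pexp2l // leq_sub2l.
rewrite sum_nat_const leq_mul2r; apply/orP; right.
apply: leq_trans (max_card _) _.
by rewrite -cardsT -powersetT card_powerset cardsT card_ord.
Qed.

Lemma pigeonhole_fiber (q k t : nat) (c : 'I_q -> 'I_k) :
  t.-1 * k < q -> exists i, t <= #|[set j | c j == i]|.
Proof.
move=> tk; apply/existsP; apply: contraLR tk => /existsPn h; rewrite -leqNgt.
have -> : q = \sum_(i < k) #|[set j | c j == i]|.
  rewrite -{1}(card_ord q) -sum1_card (partition_big c predT) //=.
  by apply: eq_bigr => i _; rewrite sum1dep_card.
have -> : t.-1 * k = \sum_(i < k) t.-1 by rewrite sum_nat_const card_ord mulnC.
apply: leq_sum => i _.
by have := h i; case: t {h} => // t; rewrite -ltnNge.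
Qed.

(** * Paths and monotone coordinates on the Steiner graph *)

Section Graph.

Variables (T : finType) (E : rel T).

Lemma path_changing_index (h : T -> nat) (x : T) (s : seq T) :
  h x != h (last x s) ->
  exists2 i, i < size s & h (nth x (x :: s) i) != h (nth x s i).
Proof.
elim: s x => [|y s IH] x /=; first by rewrite eqxx.
have [exy|nxy] := eqVneq (h x) (h y); last by exists 0.
rewrite exy => /IH[i is1 hi]; exists i.+1 => //=.
by rewrite (set_nth_default y x is1) (@set_nth_default _ (y :: s) y x) // ltnS ltnW.
Qed.

Lemma path_edge (x : T) (s : seq T) (i : nat) :
  path E x s -> i < size s ->
  [/\ E (nth x (x :: s) i) (nth x s i), connect E x (nth x (x :: s) i)
    & connect E (nth x s i) (last x s)].
Proof.
move=> ps is1; split; first by move/pathP: ps => /(_ x) ->.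
- by apply: path_connect ps _ _; rewrite mem_nth //= ltnS ltnW.
- have st := cat_take_drop i.+1 s.
  have lt : last x (take i.+1 s) = nth x s i.
    by rewrite (take_nth x) // last_rcons.
  move: ps; rewrite -{1}st cat_path lt => /andP[_ pd].
  by apply/connectP; exists (drop i.+1 s) => //; rewrite -{1}st last_cat lt.
Qed.

(** Each coordinate selects an edge on which it changes; [q] coordinates share at most [k] edges, so
    some edge is selected [t] times. *)
Lemma path_heavy_edge (q k t : nat) (h : 'I_q -> T -> nat) (x : T) (s : seq T) :
  path E x s -> size s <= k -> (forall j, h j x != h j (last x s)) ->
  0 < t -> t.-1 * k < q ->
  exists e : T * T, [/\ E e.1 e.2, connect E x e.1, connect E e.2 (last x s)
    & t <= #|[set j | h j e.1 != h j e.2]|].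
Proof.
move=> ps sk hx t0 tk.
have H j : exists i : 'I_k, i < size s /\ h j (nth x (x :: s) i) != h j (nth x s i).
  have [i is1 hi] := path_changing_index (hx j).
  by exists (Ordinal (leq_trans is1 sk)).
have [c hc] := fin_all_exists H.
have [i ti] := pigeonhole_fiber c tk.
(* A nonempty fibre shows that [i], so far only below [k], is the index of an actual edge of the
   path. *)
have /card_gt0P[j0] := leq_trans t0 ti; rewrite inE => /eqP cj0.
have is1 : i < size s by rewrite -cj0; case: (hc j0).
have [e1 e2 e3] := path_edge ps is1.
exists (nth x (x :: s) i, nth x s i); split=> //.
apply: leq_trans ti _; apply: subset_leq_card; apply/subsetP => j.
by rewrite !inE => /eqP <-; case: (hc j).
Qed.

(* Extends a coordinate of the poset to all Steiner vertices. *)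
Definition steiner_coord (V : finType) (emb : V -> T) (f : V -> nat) (w : T) : nat :=
  \max_(z | connect E (emb z) w) f z.

Variables (V : finType) (emb : V -> T) (f : V -> nat).

Lemma steiner_coord_mono (w w' : T) :
  connect E w w' -> steiner_coord emb f w <= steiner_coord emb f w'.
Proof.
move=> ww'; apply/bigmax_leqP => z zw.
by apply: (leq_bigmax_cond (F := f)); apply: connect_trans zw ww'.
Qed.

Lemma steiner_coord_emb (x : V) :
  (forall z, connect E (emb z) (emb x) -> f z <= f x) -> steiner_coord emb f (emb x) = f x.
Proof.
move=> h; apply/eqP; rewrite eqn_leq; apply/andP; split.
  by apply/bigmax_leqP => z /h.
by apply: (leq_bigmax_cond (F := f)); apply: connect0.
Qed.

End Graph.

(** * Double counting of heavy edges *)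

Section HaltonSpanner.

Variables (q : nat) (p : 'I_q -> nat) (A m : nat).
Hypothesis p_gt1 : forall j, 1 < p j.
Hypothesis p_coprime : forall i j, i != j -> coprime (p i) (p j).
Let P := \prod_j p j.
Hypothesis A_small : 2 * P ^ A <= m.

Variables (T : finType) (E : rel T) (emb : 'I_m -> T) (k t : nat).
Hypothesis emb_path : forall x y : 'I_m, halton_le p A x y ->
  exists s, [/\ size s <= k, path E (emb x) s & last (emb x) s = emb y].
Hypothesis emb_connect : forall x y : 'I_m, connect E (emb x) (emb y) -> halton_le p A x y.
Hypothesis t_gt0 : 0 < t.
Hypothesis t_small : t.-1 * k < q.

Let g (j : 'I_q) := steiner_coord E emb (fun z : 'I_m => digit_rev (p j) A z).
Let gz := steiner_coord E emb (fun z : 'I_m => z : nat).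

Let p_gt0 j : 0 < p j. Proof. exact: ltnW. Qed.
Let P_gt0 : 0 < P. Proof. by rewrite prodn_gt0. Qed.

Let g_emb j (x : 'I_m) : g j (emb x) = digit_rev (p j) A x.
Proof.
by apply: steiner_coord_emb => z /emb_connect /andP[_ /forallP].
Qed.

Let gz_emb (x : 'I_m) : gz (emb x) = x.
Proof. by apply: steiner_coord_emb => z /emb_connect /andP[]. Qed.

(* The edge stays in one [p j]-adic interval of depth [l] but changes the one
   of depth [l + 1]. *)
Definition crosses (e : T * T) (j : 'I_q) : pred 'I_A := fun l =>
  (g j e.1 %/ p j ^ (A - l) == g j e.2 %/ p j ^ (A - l)) &&
  (g j e.1 %/ p j ^ (A - l.+1) != g j e.2 %/ p j ^ (A - l.+1)).

(** The intervals are nested: ends separated at depth [l + 1] stay separated at every greater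
    depth. *)
Lemma crosses_unique (e : T * T) (j : 'I_q) : #|crosses e j| <= 1.
Proof.
have lt_false (l l' : 'I_A) : l < l' -> crosses e j l -> crosses e j l' -> False.
  move=> ll' /andP[_ /eqP ne] /andP[/eqP eq _]; apply: ne.
  have -> : A - l.+1 = (A - l') + (l' - l.+1) by have := ltn_ord l'; lia.
  by rewrite expnD !divnMA eq.
apply/card_le1_eqP => l l' hl hl'; apply/val_inj/eqP.
by case: ltngtP => // h; exfalso; [exact: (lt_false _ _ h hl' hl) | exact: (lt_false _ _ h hl hl')].
Qed.

Definition heavy (a : {ffun 'I_q -> 'I_A}) : {set T * T} :=
  [set e | E e.1 e.2 & t <= #|[set j | crosses e j (a j)]|].

(** Both the block [i] and the box of [r] can be read off the tail of the edge, so different pairs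
    receive different edges. *)
Lemma heavy_edge (a : {ffun 'I_q -> 'I_A}) (r i : nat) :
  let W := 2 * (\prod_j p j ^ a j * P) in
  i < m %/ W ->
  exists e, [/\ e \in heavy a, gz e.1 %/ W = i &
    forall j, g j e.1 %/ p j ^ (A - a j) = digit_rev (p j) (a j) r].
Proof.
move=> W iW; have W0 : 0 < W.
  by rewrite !muln_gt0 P_gt0 prodn_gt0 // => j; rewrite expn_gt0 p_gt0.
have [x [y [xy ix iy hr hd]]] := halton_pair p_gt1 p_coprime a r i.
have ym : y < m.
  by apply: leq_trans iy _; apply: leq_trans (leq_trunc_div m W); rewrite leq_mul2r iW orbT.
have xm : x < m by apply: leq_ltn_trans ym; case/andP: xy.
have [s [sk ps ls]] := @emb_path (Ordinal xm) (Ordinal ym) xy.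
pose h j w := g j w %/ p j ^ (A - (a j).+1).
have [|e [Ee c1 c2 te]] := path_heavy_edge (h := h) ps sk _ t_gt0 t_small.
  by move=> j; rewrite /h ls !g_emb /= !digit_rev_div // neq_ltn hd.
rewrite ls in c2.
have c12 : connect E e.1 e.2 by apply: connect1.
(* By monotonicity both ends of [e] are squeezed between [x] and [y], which lie in the same box. *)
have box j : g j e.1 %/ p j ^ (A - a j) = digit_rev (p j) (a j) r /\
             g j e.2 %/ p j ^ (A - a j) = digit_rev (p j) (a j) r.
  have [hx hy] := hr j; have aA := ltnW (ltn_ord (a j)).
  have l1 : digit_rev (p j) (a j) r <= g j e.1 %/ p j ^ (A - a j).
    by rewrite -hx -(digit_rev_div (p_gt0 j) x aA) leq_div2r // -(g_emb j (Ordinal xm)) steiner_coord_mono.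
  have l2 : g j e.2 %/ p j ^ (A - a j) <= digit_rev (p j) (a j) r.
    by rewrite -hy -(digit_rev_div (p_gt0 j) y aA) leq_div2r // -(g_emb j (Ordinal ym)) steiner_coord_mono.
  have l3 : g j e.1 %/ p j ^ (A - a j) <= g j e.2 %/ p j ^ (A - a j).
    by rewrite leq_div2r // steiner_coord_mono.
  by lia.
exists e; split; last by move=> j; case: (box j).
- rewrite inE Ee; apply: leq_trans te _; apply: subset_leq_card; apply/subsetP => j.
  by rewrite !inE => hj; have [b1 b2] := box j; rewrite /crosses b1 b2 eqxx.
- have z1 : i * W <= gz e.1.
    by apply: leq_trans ix _; rewrite -[x](gz_emb (Ordinal xm)) steiner_coord_mono.
  have z2 : gz e.1 < i.+1 * W.
    apply: leq_ltn_trans iy; rewrite -[y](gz_emb (Ordinal ym)) steiner_coord_mono //.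
    exact: connect_trans c12 c2.
  by apply/eqP; rewrite eqn_leq -ltnS ltn_divLR // z2 leq_divRL // z1.
Qed.

Lemma card_heavy (a : {ffun 'I_q -> 'I_A}) : m <= 4 * P * #|heavy a|.
Proof.
pose Q := \prod_j p j ^ a j; pose W := 2 * (Q * P).
have W0 : 0 < W.
  by rewrite !muln_gt0 P_gt0 prodn_gt0 // => j; rewrite expn_gt0 p_gt0.
have H (ri : 'I_Q * 'I_(m %/ W)) : exists e, [/\ e \in heavy a, gz e.1 %/ W = ri.2 &
    forall j, g j e.1 %/ p j ^ (A - a j) = digit_rev (p j) (a j) ri.1].
  exact: (heavy_edge ri.1 (ltn_ord ri.2)).
have [F hF] := fin_all_exists H.
have F_inj : injective F.
  move=> [r i] [r' i'] eF; have [_ i1 r1] := hF (r, i); have [_ i2 r2] := hF (r', i').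
  rewrite eF in i1 r1; congr pair; apply: val_inj; last exact: etrans (esym i1) i2.
  have : r = r' %[mod Q].
    apply: eq_mod_prod => [j j' nj|j]; first by rewrite coprimeXl // coprimeXr // p_coprime.
    by apply/digit_rev_eqP => //; rewrite -[LHS]r1 -[RHS]r2.
  by rewrite !modn_small.
have : #|F @: [set: 'I_Q * 'I_(m %/ W)]| <= #|heavy a|.
  apply: subset_leq_card; apply/subsetP => e /imsetP[ri _ ->]; by case: (hF ri).
rewrite card_imset // cardsT card_prod !card_ord => /(leq_mul (leqnn (4 * P))).
apply: leq_trans.
(* Since [4 * P * Q = 2 * W], one copy of [m %/ W * W] covers the quotient part of [m] and the other
   its remainder, the quotient being positive. *)
have -> : 4 * P * (Q * (m %/ W)) = m %/ W * W + m %/ W * W by rewrite /W; move: (m %/ _) => D; nia.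
have Wm : 0 < m %/ W by rewrite divn_gt0 //; apply: leq_trans A_small; apply: period_le.
by rewrite {1}(divn_eq m W) leq_add2l ltnW // (leq_trans (ltn_pmod m W0)) // leq_pmull.
Qed.

(** Counts the pairs of a tuple [a] and an edge heavy for [a]: from below by [card_heavy] for each
    tuple, from above by [card_agreeing_ffun] for each edge. *)
Lemma halton_spanner_edges : 0 < A -> t <= q -> m * A ^ t <= 4 * P * 2 ^ q * num_edges E.
Proof.
move=> A0 tq.
have h1 : m * A ^ q <= 4 * P * \sum_(a : {ffun 'I_q -> 'I_A}) #|heavy a|.
  have -> : A ^ q = #|{: {ffun 'I_q -> 'I_A}}| by rewrite card_ffun !card_ord.
  rewrite mulnC -sum_nat_const big_distrr; apply: leq_sum => a _; exact: card_heavy.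
have h2 : \sum_(a : {ffun 'I_q -> 'I_A}) #|heavy a| <= num_edges E * (2 ^ q * A ^ (q - t)).
  have -> : \sum_(a : {ffun 'I_q -> 'I_A}) #|heavy a| =
      \sum_(e | E e.1 e.2) #|[set a : {ffun 'I_q -> 'I_A} | t <= #|[set j | crosses e j (a j)]|]|.
    rewrite (eq_bigr (fun a => \sum_(e in heavy a) 1)); last by move=> a _; rewrite sum1_card.
    rewrite (exchange_big_dep (fun e : T * T => E e.1 e.2)) /=.
      apply: eq_bigr => e Ee; rewrite -sum1_card; apply: eq_bigl => a.
      by rewrite !inE Ee.
    by move=> a e _; rewrite inE => /andP[].
  rewrite /num_edges -sum1_card big_distrl /= [X in _ <= X](eq_bigl (fun e : T * T => E e.1 e.2)).
    by apply: leq_sum => e _; rewrite mul1n; apply: card_agreeing_ffun => //; apply: crosses_unique.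
  by move=> e; rewrite inE.
have Aq : A ^ q = A ^ t * A ^ (q - t) by rewrite -expnD subnKC.
have Apos : 0 < A ^ (q - t) by rewrite expn_gt0 A0.
rewrite -(leq_pmul2r Apos) -mulnA -Aq; apply: leq_trans h1 _.
apply: leq_trans (leq_mul (leqnn _) h2) _.
by apply: eq_leq; rewrite -!mulnA; congr (_ * (_ * _)); rewrite mulnCA.
Qed.

End HaltonSpanner.

(** * Pairwise coprime bases *)

Fixpoint nth_prime (j : nat) : nat :=
  if j is i.+1 then s2val (prime_above (nth_prime i)) else 2.

Lemma nth_prime_prime (j : nat) : prime (nth_prime j).
Proof. by case: j => // j /=; case: (prime_above _). Qed.

Lemma nth_prime_ltS (j : nat) : nth_prime j < nth_prime j.+1.
Proof. by rewrite /=; case: (prime_above _). Qed.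

Lemma nth_prime_coprime (i j : nat) : i != j -> coprime (nth_prime i) (nth_prime j).
Proof.
have lt a b : a < b -> nth_prime a < nth_prime b.
  elim: b => // b IH; rewrite ltnS leq_eqVlt => /predU1P[->|/IH h].
    exact: nth_prime_ltS.
  exact: ltn_trans h (nth_prime_ltS b).
move=> nij; rewrite prime_coprime ?nth_prime_prime // dvdn_prime2 ?nth_prime_prime //.
by rewrite neq_ltn; case: (ltngtP i j) nij => // /lt -> _; rewrite ?orbT.
Qed.

(** * Dominance orders and dimension *)

Definition dominance (n d : nat) (f : 'I_n -> 'I_d -> nat) : rel 'I_n :=
  fun x y => [forall j, f x j <= f y j].

Lemma dominance_poset (n d : nat) (f : 'I_n -> 'I_d -> nat) :
  (forall x y, (forall j, f x j = f y j) -> x = y) -> is_poset (dominance f).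
Proof.
move=> inj; split; first by move=> x; apply/forallP.
split=> [x y /andP[/forallP xy /forallP yx]|y x z /forallP xy /forallP yz].
  by apply: inj => j; apply/eqP; rewrite eqn_leq xy yx.
by apply/forallP => j; apply: leq_trans (xy j) (yz j).
Qed.

(* Replacing each coordinate by its rank brings the values below [n]. *)
Lemma dominance_embeds (n d : nat) (f : 'I_n -> 'I_d -> nat) :
  embeds_dominance (dominance f) d.
Proof.
have rank_lt x j : #|[set z | f z j < f x j]| < n.
  rewrite -[X in _ < X](card_ord n) -cardsT; apply: proper_card.
  by apply/properP; split; [exact: subsetT | exists x; rewrite ?inE // ltnn].
exists (fun x j => Ordinal (rank_lt x j)) => x y; split=> [/forallP xy j /=|xy].
  apply: subset_leq_card; apply/subsetP => z; rewrite !inE => h.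
  exact: leq_trans h (xy j).
apply/forallP => j; rewrite leqNgt; apply/negP => yx.
have := xy j; rewrite /= leqNgt => /negP; apply; apply: proper_card.
apply/properP; split; last by exists y; rewrite inE ?ltnn.
by apply/subsetP => z; rewrite !inE => h; apply: ltn_trans h yx.
Qed.

(** Each [i] needs a coordinate [c i] with [b i] below [a i]. If [i] and [j] shared it, then
    [b i < a i <= b j < a j <= b i] there, a contradiction. *)
Lemma standard_example_dim (n d : nat) (le : rel 'I_n) (a b : 'I_d -> 'I_n) (d' : nat) :
  (forall i j, le (a i) (b j) = (i != j)) -> d' < d -> ~ embeds_dominance le d'.
Proof.
move=> ab dd [f hf].
have H i : exists j, f (b i) j < f (a i) j.
  apply/existsP; apply: contraT => /existsPn h.
  have : le (a i) (b i) by apply/hf => j; rewrite leqNgt h.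
  by rewrite ab eqxx.
have [c hc] := fin_all_exists H.
have c_inj : injective c.
  move=> i j eij; apply/eqP; apply: contraT => nij.
  have lij : le (a i) (b j) by rewrite ab.
  have lji : le (a j) (b i) by rewrite ab eq_sym.
  have := proj1 (hf _ _) lij (c i); have := proj1 (hf _ _) lji (c i).
  by have := hc i; have := hc j; rewrite -eij; lia.
by have := leq_card c c_inj; rewrite !card_ord leqNgt dd.
Qed.

(** * The hard poset *)

(* Minimal elements of the standard example are [x < d], maximal ones
   [d <= x < 2 d]; ties are broken by [x]. *)
Definition standard_coord (d x j : nat) : nat :=
  (if x < d then x == j else x - d != j) * (2 * d) + x.

(** Standard coordinates stay below [4 * q.+1], so this offset places all Halton points above the
    standard example. *)
Definition hard_coord (q A : nat) (x j : nat) : nat :=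
  if x < 2 * q.+1 then standard_coord q.+1 x j
  else 4 * q.+1 + (if j < q then digit_rev (nth_prime j) A (x - 2 * q.+1) else x - 2 * q.+1).

Section HardPoset.

Variables (q A m : nat).
Let n := 2 * q.+1 + m.

Definition hard_le : rel 'I_n :=
  dominance (fun (x : 'I_n) (j : 'I_q.+1) => hard_coord q A x j).

Lemma hard_le_poset : is_poset hard_le.
Proof.
(* The last coordinate alone separates points: modulo [2 * q.+1] it returns [x] on the standard
   example, and on the Halton part it is a shift of the index. *)
apply: dominance_poset => x y /(_ ord_max); rewrite /hard_coord /standard_coord /= ltnn.
move=> e; apply: val_inj => /=; move: e.
have md b (z : nat) : z < 2 * q.+1 -> (b * (2 * q.+1) + z) %% (2 * q.+1) = z.
  by move=> zd; rewrite modnMDl modn_small.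
have ltd (b : bool) (z : nat) : z < 2 * q.+1 -> b * (2 * q.+1) + z < 4 * q.+1.
  by case: b; lia.
case: (ltnP x (2 * q.+1)) => xd; case: (ltnP y (2 * q.+1)) => yd.
- by move/(congr1 (modn^~ (2 * q.+1))); rewrite /= !md.
- by set b := (if _ then _ else _); have := ltd b _ xd; lia.
- by set b := (if _ then _ else _); have := ltd b _ yd; lia.
- by lia.
Qed.

Lemma hard_le_dim : poset_dim_eq hard_le q.+1.
Proof.
split; first exact: dominance_embeds.
have an (i : 'I_q.+1) : i < n by rewrite /n; have := ltn_ord i; lia.
have bn (i : 'I_q.+1) : q.+1 + i < n by rewrite /n; have := ltn_ord i; lia.
move=> d'; apply: (@standard_example_dim _ _ _ (fun i => Ordinal (an i)) (fun i => Ordinal (bn i))).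
move=> i j; have iq := ltn_ord i; have jq := ltn_ord j.
have i2 : i < 2 * q.+1 by lia.
have j2 : q.+1 + j < 2 * q.+1 by lia.
have jN : (q.+1 + j < q.+1) = false by lia.
apply/forallP/idP => [/(_ i)|nij l]; rewrite /hard_coord /standard_coord /= i2 j2 iq jN addKn.
  by rewrite eqxx [nat_of_ord j == i]eq_sym; case: (eqVneq i j) => [->|] //=; rewrite ?eqxx /=; lia.
case: (eqVneq (i : nat) l) => [<-|_] /=; last by lia.
have -> : (nat_of_ord j == i) = false by apply/negbTE; rewrite eq_sym; apply: nij.
by rewrite /=; lia.
Qed.

Lemma hard_le_halton (x y : 'I_m) :
  hard_le (rshift (2 * q.+1) x) (rshift (2 * q.+1) y) =
  halton_le (fun j : 'I_q => nth_prime j) A x y.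
Proof.
have big (z : nat) : (2 * q.+1 + z < 2 * q.+1) = false by lia.
apply/forallP/andP => [h|[xy /forallP h] j].
  split; first by have := h ord_max; rewrite /hard_coord /= !big ltnn !addKn leq_add2l.
  apply/forallP => j; have := h (widen_ord (leqnSn q) j).
  by rewrite /hard_coord /= !big ltn_ord !addKn leq_add2l.
rewrite /hard_coord /= !big !addKn leq_add2l; case: ifP => // jq.
exact: (h (Ordinal jq)).
Qed.

End HardPoset.

(** * Logarithm estimates and the final bound *)

Lemma INR_expn (a b : nat) : INR (a ^ b) = (INR a ^ b)%R.
Proof. by elim: b => //= b IH; rewrite expnS mult_INR IH. Qed.

Lemma ln_le_mono (x y : R) : (0 < x)%R -> (x <= y)%R -> (ln x <= ln y)%R.
Proof.
move=> x0 [xy|->]; last exact: Rle_refl.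
exact/Rlt_le/ln_increasing.
Qed.

Lemma log2_le (n b : nat) : 0 < n -> n <= 2 ^ b -> (0 <= log2 (INR n) <= INR b)%R.
Proof.
move=> n0 nb.
have l2 : (0 < ln 2)%R by rewrite -ln_1; apply: ln_increasing; lra.
have n1 : (1 <= INR n)%R by apply: (le_INR 1); apply/leP.
rewrite /log2; split.
  apply: Rmult_le_pos; last by apply/Rlt_le/Rinv_0_lt_compat.
  by rewrite -ln_1; apply: ln_le_mono; lra.
apply: (Rmult_le_reg_r (ln 2)) => //.
rewrite /Rdiv Rmult_assoc Rinv_l ?Rmult_1_r; last by lra.
rewrite -ln_pow; last by lra.
apply: ln_le_mono; first by lra.
by have := le_INR _ _ (leP nb); rewrite INR_expn.
Qed.

Lemma ceil_div_bounds (q k : nat) : 0 < q -> 0 < k ->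
  [/\ 0 < ceil_div q k, (ceil_div q k).-1 * k < q & ceil_div q k <= q].
Proof.
move=> q0 k0; rewrite /ceil_div.
have t0 : 0 < (q + k - 1) %/ k by rewrite divn_gt0 //; lia.
have tk := leq_trunc_div (q + k - 1) k.
have tq : ((q + k - 1) %/ k).-1 * k < q by move: t0 tk; move: (_ %/ _) => [|t] //=; rewrite mulSn; lia.
split=> //; have := leq_pmulr ((q + k - 1) %/ k).-1 k0; lia.
Qed.

Theorem theorem2 :
  forall d : nat, 2 <= d ->
  exists c : R, (0 < c)%R /\
  exists N : nat, forall n : nat, N <= n ->
  exists le : rel 'I_n,
    is_poset le /\ poset_dim_eq le d /\
    forall k : nat, 3 <= k ->
    forall (T : finType) (E : rel T) (emb : 'I_n -> T),
      steiner_tc_spanner le k E emb ->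
      (c * INR n * (log2 (INR n)) ^ (ceil_div (d - 1) k) <= INR (num_edges E))%R.
Proof.
case=> // q; rewrite ltnS subn1 /= => q0.
pose p (j : 'I_q) := nth_prime j.
have p_gt1 j : 1 < p j by apply: prime_gt1; apply: nth_prime_prime.
have p_coprime i j : i != j -> coprime (p i) (p j) by move=> nij; apply: nth_prime_coprime.
pose P := \prod_j p j.
have P_gt1 : 1 < P.
  rewrite /P (bigD1 (Ordinal q0)) //=; apply: (leq_trans (p_gt1 (Ordinal q0))).
  by rewrite leq_pmulr // prodn_gt0 // => j; apply: ltnW.
(* [K] is chosen so that [log2 n <= K * A], [C] is the constant of [halton_spanner_edges], and the 2
   in [D] pays for [n <= 2 * m]. *)
pose K := 2 + 2 * P; pose C := 4 * P * 2 ^ q; pose D := 2 * C * K ^ q.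
have D_gt0 : 0 < D by rewrite !muln_gt0 !expn_gt0 /=; lia.
have D_pos : (0 < INR D)%R by apply: (lt_INR 0); apply/ltP.
exists (/ INR D)%R; split; first exact: Rinv_0_lt_compat.
(* The threshold ensures [n <= 2 * m] and [2 * P <= m], hence [0 < A]. *)
exists (4 * q.+1 + 2 * P) => n nN.
have [m en] : exists m, n = 2 * q.+1 + m by exists (n - 2 * q.+1); lia.
subst n; have mP : 2 * q.+1 + 2 * P <= m by lia.
pose A := trunc_log P (m %/ 2).
have A0 : 0 < A by rewrite trunc_log_gt0 P_gt1 /=; lia.
have A_small : 2 * P ^ A <= m.
  have := @trunc_logP P (m %/ 2) P_gt1; rewrite -/A; move: (P ^ A) => X; lia.
(* Here [n <= 2 * m < 4 * P ^ A.+1], [P < 2 ^ P], and [2 + P * A.+1 <= K * A] because [A] is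
   positive. *)
have A_big : 2 * q.+1 + m <= 2 ^ (K * A).
  have h1 : m %/ 2 < P ^ A.+1 by apply: trunc_log_ltn.
  have h2 : P ^ A.+1 <= 2 ^ (P * A.+1).
    by rewrite expnM leq_exp2r // ltnW // ltn_expl.
  apply: (@leq_trans (4 * 2 ^ (P * A.+1))).
    by move: h1 h2; move: (P ^ _) (2 ^ _) => X Y; lia.
  rewrite -(expnD 2 2) leq_pexp2l // /K; nia.
exists (hard_le A (m := m)); split; first exact: hard_le_poset.
split; first exact: hard_le_dim.
move=> k k3 T E emb [_ sp].
have [t0 tk tq] := ceil_div_bounds q0 (ltnW (ltnW k3)).
move: (ceil_div q k) t0 tk tq => t t0 tk tq.
(* The whole graph [E] is also a Steiner spanner of the Halton part alone. *)
have bound : m * A ^ t <= C * num_edges E.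
  apply: (@halton_spanner_edges q p A m p_gt1 p_coprime A_small T E
            (fun x => emb (rshift (2 * q.+1) x)) k t) => //.
    by move=> x y; rewrite -hard_le_halton => /(proj1 (sp _ _)).
  move=> x y; apply: contraTT; rewrite -hard_le_halton; exact: (proj2 (sp _ _)).
set n := 2 * q.+1 + m in A_big *.
(* Bounding [K ^ t] by [K ^ q] keeps the constant independent of [k]. *)
have bound' : n * (K * A) ^ t <= D * num_edges E.
  apply: (@leq_trans (2 * m * (K ^ q * A ^ t))).
    rewrite expnMn leq_mul //; first by rewrite /n; lia.
    by apply: leq_mul => //; apply: leq_pexp2l.
  have -> : 2 * m * (K ^ q * A ^ t) = 2 * K ^ q * (m * A ^ t) by rewrite -!mulnA; congr (_ * _); rewrite mulnCA.
  have -> : D * num_edges E = 2 * K ^ q * (C * num_edges E).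
    by rewrite /D (mulnAC 2 C) mulnA.
  by rewrite leq_mul2l bound orbT.
have n0 : 0 < n by rewrite /n; lia.
have [L0 L1] := log2_le n0 A_big.
have Lt : (log2 (INR n) ^ t <= INR ((K * A) ^ t))%R.
  by rewrite INR_expn; apply: pow_incr.
apply: (Rmult_le_reg_l (INR D)) => //.
rewrite -!Rmult_assoc Rinv_r ?Rmult_1_l; last by lra.
apply: Rle_trans (Rmult_le_compat_l _ _ _ (pos_INR n) Lt) _.
by rewrite -!mult_INR; apply: le_INR; apply/leP.
Qed.
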